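(* Let $d\ge 8$ be even. Let $\mathbb F_q$ range over finite fields with $q$ elements whose characteristic is not $2$, and for $E\subset\mathbb F_q^d$ let $\Delta_3(E)=\{\|\mathbf x_1+\mathbf x_2+\mathbf x_3\|: \mathbf x_1,\mathbf x_2,\mathbf x_3\in E\}\subset\mathbb F_q$. Then there is a constant $0<c\le 1$ independent of $q$ such that for every $\varepsilon>0$ there exists $C_\varepsilon>0$ (independent of $q$) with the property: for every such $q$ and every $E\subset\mathbb F_q^d$ with $|E|\ge C_\varepsilon q^{\frac{d+1}{2}-\frac{1}{9d-18}+\varepsilon}$, we have $|\Delta_3(E)|\ge c q$.
   Context: For $\mathbf v=(v_1,\dots,v_d)\in\mathbb F_q^d$, $\|\mathbf v\|=v_1^2+\cdots+v_d^2\in\mathbb F_q$. *)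

(* Defs.v *)
From mathcomp Require Import all_boot all_order all_algebra.

Set Implicit Arguments.
Unset Strict Implicit.
Unset Printing Implicit Defensive.

Import GRing.Theory.
Local Open Scope ring_scope.

(* The quadratic form v_1^2 + ... + v_d^2, with values in F itself; it is not
   a norm in the metric sense. *)
Definition sqnorm (F : finFieldType) (d : nat) (v : 'rV[F]_d) : F :=
  \sum_(i < d) v 0 i ^+ 2.

(* The summands x1, x2, x3 need not be distinct. *)
Definition Delta3 (F : finFieldType) (d : nat) (E : {set 'rV[F]_d}) : {set F} :=
  [set t | [exists x1 in E, exists x2 in E, exists x3 in E,
              t == sqnorm (x1 + x2 + x3)]].

(* Main.v *)
(* The number N(t) of triples of E with ||x1 + x2 + x3|| = t is expanded with
   an additive character psi and Gauss sums.  With Ehat the Fourier transform of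
   E and B(r) the sum of Ehat^3 over the sphere ||m|| = r, the term B(0) comes
   with the weight q 1[t = 0] - 1 because the Gauss sum to an even power d does
   not depend on the frequency; so it is harmless for t <> 0, and Cauchy-Schwarz
   over t <> 0 leaves the L^2 norm of B over the nonzero radii to be bounded.

   For r <> 0 put f = |Ehat|^2 on the sphere S of radius r, of total mass F.  By
   duality and Hoelder the cube sum of |Ehat| over S is controlled by the
   additive energy of f, and an additive quadruple of S is a rectangle, so only
   the f-mass of the right angles (a - c).(b - c) = 0 in S matters.  If that mass
   were close to F^3, then for some c one could choose k = d/2 independent b - c
   all orthogonal to a - c for a large part of the a's, which would put much of f
   on an affine k-space; but such a space meets S in at most 2 q^(k-1) points,
   since a totally isotropic k-space is its own orthogonal complement.  This
   yields the exponent (d+1)/2 - 1/(4d-2), below the required one. *)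
Require Import Defs.
From mathcomp Require Import all_boot all_order all_algebra.
From mathcomp Require Import all_fingroup all_field all_character.
From mathcomp Require Import reals exp.
From mathcomp Require Import ring lra zify.

Set Implicit Arguments.
Unset Strict Implicit.
Unset Printing Implicit Defensive.

Import Order.TTheory GRing.Theory Num.Theory.
Local Open Scope ring_scope.

(** * The quadratic form, its spheres, and their intersections with flats *)

Section Geometry.
Variables (F : finFieldType) (d : nat).
Implicit Types (u v w : 'rV[F]_d) (r t : F).

Definition dot u v : F := (u *m v^T) 0 0.

Lemma dotE u v : dot u v = \sum_i u 0 i * v 0 i.
Proof. by rewrite /dot mxE; apply: eq_bigr => i _; rewrite mxE. Qed.

Lemma sqnormE v : sqnorm v = dot v v.
Proof. by rewrite dotE; apply: eq_bigr => i _; rewrite expr2. Qed.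

Lemma dotC u v : dot u v = dot v u.
Proof. by rewrite !dotE; apply: eq_bigr => i _; rewrite mulrC. Qed.

Lemma dotDl u v w : dot (u + v) w = dot u w + dot v w.
Proof. by rewrite /dot mulmxDl mxE. Qed.

Lemma dotDr u v w : dot u (v + w) = dot u v + dot u w.
Proof. by rewrite dotC dotDl !(dotC u). Qed.

Lemma dotZl t u v : dot (t *: u) v = t * dot u v.
Proof. by rewrite /dot -scalemxAl mxE. Qed.

Lemma dotZr t u v : dot u (t *: v) = t * dot u v.
Proof. by rewrite dotC dotZl dotC. Qed.

Lemma dotNl u v : dot (- u) v = - dot u v.
Proof. by rewrite -scaleN1r dotZl mulN1r. Qed.

Lemma dotNr u v : dot u (- v) = - dot u v.
Proof. by rewrite dotC dotNl dotC. Qed.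

Lemma dot0r u : dot u 0 = 0.
Proof. by rewrite -(scale0r 0) dotZr mul0r. Qed.

Lemma dotBl u v w : dot (u - v) w = dot u w - dot v w.
Proof. by rewrite dotDl dotNl. Qed.

Lemma sqnorm0 : sqnorm (0 : 'rV[F]_d) = 0.
Proof. by rewrite sqnormE dot0r. Qed.

Lemma sqnormD u v : sqnorm (u + v) = sqnorm u + 2%:R * dot u v + sqnorm v.
Proof. by rewrite !sqnormE dotDl !dotDr (dotC v u); ring. Qed.

Lemma sqnormZ t v : sqnorm (t *: v) = t ^+ 2 * sqnorm v.
Proof. by rewrite !sqnormE dotZl dotZr mulrA -expr2. Qed.

(** For points of value [r], [sqnorm (a + b - c)] expands to r + 2 (a - c).(b - c), and 2 is
    invertible. *)
Lemma inscribed_parallelogram_rectangle a b c r : 2%:R != 0 :> F ->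
  sqnorm a = r -> sqnorm b = r -> sqnorm c = r -> sqnorm (a + b - c) = r ->
  dot (a - c) (b - c) = 0.
Proof.
move=> nz2 ha hb hc habc; apply: (mulfI nz2); rewrite mulr0.
move: habc; rewrite !(sqnormD, sqnormE) !(dotDl, dotDr, dotNl, dotNr).
move: ha hb hc; rewrite !sqnormE => -> -> -> /eqP.
rewrite -subr_eq0 => /eqP <-; rewrite (dotC b c); ring.
Qed.

Lemma card_quadratic_roots (a b c : F) : (a != 0) || (b != 0) ->
  (#|[set t : F | (a * t ^+ 2 + b * t + c == 0)%R]| <= 2)%N.
Proof.
move=> ab; pose p := Poly [:: c; b; a].
have p0 : p != 0.
  apply: contraL ab => /eqP p0.
  have := congr1 (fun q : {poly F} => q`_1) p0; rewrite coef_Poly coef0 /= => ->.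
  have := congr1 (fun q : {poly F} => q`_2) p0; rewrite coef_Poly coef0 /= => ->.
  by rewrite eqxx.
rewrite cardE -ltnS; apply: leq_trans (size_Poly [:: c; b; a]).
apply: max_poly_roots; rewrite ?enum_uniq //; apply/allP => t.
rewrite mem_enum inE /root /p => /eqP <-.
by rewrite horner_Poly /= mul0r add0r; apply/eqP; ring.
Qed.

Lemma card_coset_submx m (A : 'M[F]_(m, d)) c :
  #|[set v : 'rV_d | (v - c <= A)%MS]| = (#|F| ^ \rank A)%N.
Proof.
rewrite -card_rowg -(card_imset (rowg A) (@addIr _ c)); apply: eq_card => v.
rewrite inE; apply/idP/imsetP => [vA | [x]].
  by exists (v - c); rewrite ?subrK ?mem_rowg.
by rewrite mem_rowg => xA ->; rewrite addrK.
Qed.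

Definition sphere r : {set 'rV[F]_d} := [set a | sqnorm a == r].

Definition orthoflat m (U : 'M[F]_(m, d)) (c : 'rV[F]_d) : {set 'rV[F]_d} :=
  [set a | (a - c) *m U^T == 0].

Lemma card_orthoflat m (U : 'M[F]_(m, d)) (c : 'rV[F]_d) :
  #|orthoflat U c| = (#|F| ^ (d - \rank U))%N.
Proof.
rewrite -mxrank_tr -mxrank_ker -(card_coset_submx _ c).
by apply: eq_card => a; rewrite !inE sub_kermx.
Qed.

Section HalfDimensional.
Variables (k : nat) (U : 'M[F]_d).
Hypotheses (dk : d = (k + k)%N) (nz2 : 2%:R != 0 :> F) (rkU : \rank U = k).

(* If every restriction to a line of the direction W were constant, then W
   would be a totally isotropic k-space orthogonal to c, hence equal to its
   own orthogonal complement, which forces c in W and r = 0. *)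
Lemma exists_transversal_direction c r (a : 'rV[F]_d) : r != 0 ->
    (a - c) *m U^T = 0 -> sqnorm a = r ->
  exists2 w, w *m U^T = 0 &
    forall x, (x - c) *m U^T = 0 -> (sqnorm w != 0) || (2%:R * dot x w != 0).
Proof.
move=> r0 aU ar.
have [/existsP[w /andP[/eqP wU w0]] | /existsPn isoW] :=
  boolP [exists w : 'rV_d, (w *m U^T == 0) && (sqnorm w != 0)].
  by exists w => // x _; rewrite w0.
have iso w : w *m U^T = 0 -> sqnorm w = 0.
  by move=> wU; move: (isoW w); rewrite wU eqxx /= negbK => /eqP.
have orth w1 w2 : w1 *m U^T = 0 -> w2 *m U^T = 0 -> dot w1 w2 = 0.
  move=> h1 h2; apply: (mulfI nz2); rewrite mulr0.
  have := iso (w1 + w2); rewrite mulmxDl h1 h2 addr0 sqnormD => /(_ erefl).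
  by rewrite (iso _ h1) (iso _ h2) add0r addr0.
have [/existsP[w /andP[/eqP wU w0]] | /existsPn cW] :=
  boolP [exists w : 'rV_d, (w *m U^T == 0) && (dot c w != 0)].
  exists w => // x xU; apply/orP; right.
  rewrite mulf_neq0 // -(subrK c x) dotDl (orth (x - c)) //.
  by rewrite add0r.
have {}cW w : w *m U^T = 0 -> dot c w = 0.
  by move=> wU; move: (cW w); rewrite wU eqxx /= negbK => /eqP.
pose W := kermx U^T.
have rkW : \rank W = k by rewrite mxrank_ker mxrank_tr rkU dk addnK.
have rowW i : row i W *m U^T = 0 by rewrite -row_mul mulmx_ker row0.
have dotrow (A : 'rV[F]_d) i : (A *m W^T) 0 i = dot A (row i W).
  by rewrite /dot !mxE; apply: eq_bigr => j _; rewrite !mxE.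
have subW : (W <= kermx W^T)%MS.
  rewrite sub_kermx; apply/eqP/row_matrixP => j; rewrite row_mul row0.
  by apply/rowP => i; rewrite dotrow mxE orth.
have eqW : (W :=: kermx W^T)%MS.
  apply/eqmxP; rewrite subW /= -(mxrank_leqif_sup subW).
  by rewrite mxrank_ker mxrank_tr rkW dk addnK.
have csub : (c <= W)%MS.
  rewrite eqW sub_kermx; apply/eqP/rowP => i; rewrite dotrow mxE.
  by apply: cW.
move: csub; rewrite sub_kermx => /eqP cU.
suff : r = 0 by move/eqP: r0.
by rewrite -ar iso // -(subrK c a) mulmxDl aU cU addr0.
Qed.

(** The pairs [(x, t)] with [x + t *: w] in the intersection are counted in two ways: each [t]
    contributes the size of the intersection, and each [x] of the flat at most two [t], the roots of
    a polynomial that is not constant by the choice of [w]. *)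
Lemma card_sphere_affine c r : r != 0 ->
  (#|F| * #|orthoflat U c :&: sphere r| <= 2 * #|F| ^ k)%N.
Proof.
move=> r0; set X := _ :&: _.
have [->|/set0Pn[a]] := eqVneq X set0; first by rewrite cards0 muln0.
rewrite !inE => /andP[/eqP aU /eqP ar].
have [w wU hw] := exists_transversal_direction r0 aU ar.
pose L := orthoflat U c.
have cardL : #|L| = (#|F| ^ k)%N by rewrite card_orthoflat rkU dk addnK.
have shift t x : (x + t *: w \in X) = (x \in L) && (sqnorm (x + t *: w) == r).
  by rewrite !inE addrAC mulmxDl -scalemxAl wU scaler0 addr0.
have cardX t : (\sum_(x : 'rV[F]_d) (x + t *: w \in X)%R = #|X|)%N.
  rewrite -sum1_card [RHS]big_mkcond /=.
  rewrite [RHS](reindex_inj (addIr (t *: w))) /=.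
  by apply: eq_bigr => x _; case: ifP.
rewrite -sum_nat_const -(eq_bigr _ (fun t _ => cardX t)) exchange_big /=.
rewrite mulnC -cardL -sum_nat_const [X in (_ <= X)%N]big_mkcond /=.
apply: leq_sum => x _; case: ifP => [xL|/negbT xL]; last first.
  by rewrite big1 // => t _; rewrite shift (negbTE xL).
have xU : (x - c) *m U^T = 0 by move: xL; rewrite inE => /eqP.
apply: leq_trans (card_quadratic_roots (sqnorm x - r) (hw x xU)).
rewrite -sum1_card [X in (_ <= X)%N]big_mkcond /=.
apply: leq_sum => t _; rewrite shift xL inE sqnormD sqnormZ dotZr -subr_eq0.
rewrite (_ : _ - r = sqnorm w * t ^+ 2 + 2%:R * dot x w * t + (sqnorm x - r)).
  by case: eqP.
by ring.
Qed.

End HalfDimensional.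
End Geometry.

(** * Weighted power means *)

Lemma eq_ler (C : numDomainType) (x y : C) : x = y -> x <= y.
Proof. by move=> ->. Qed.

(** Twice the difference of the sides is the double sum of [f a * f b * ((p a - p b) * (p a ^+ n - p
    b ^+ n))], where the last difference is a nonnegative multiple of [p a - p b]. *)
Lemma weighted_chebyshev (C : numDomainType) (T : finType) (f p : T -> C) n :
    (forall a, 0 <= f a) -> (forall a, 0 <= p a) ->
  (\sum_a f a * p a) * (\sum_a f a * p a ^+ n)
    <= (\sum_a f a) * (\sum_a f a * p a ^+ n.+1).
Proof.
move=> f0 p0; set S1 := \sum_a f a * p a; set Sn := \sum_a f a * p a ^+ n.
set S0 := \sum_a f a; set Sn1 := \sum_a f a * p a ^+ n.+1.
have pos x y : 0 <= (p x - p y) * (p x ^+ n - p y ^+ n).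
  rewrite subrXX mulrA -expr2 mulr_ge0 //.
    by rewrite real_exprn_even_ge0 // realB ?ger0_real.
  by apply: sumr_ge0 => i _; rewrite mulr_ge0 ?exprn_ge0.
rewrite -subr_ge0 -(pmulrn_lge0 _ (isT : (0 < 2)%N)).
have -> : (S0 * Sn1 - S1 * Sn) *+ 2 =
    S0 * Sn1 + Sn1 * S0 - (S1 * Sn + Sn * S1) by ring.
rewrite !big_distrlr /= -!big_split -sumrB /=; apply: sumr_ge0 => a _.
rewrite -!big_split -sumrB /=; apply: sumr_ge0 => b _.
have := mulr_ge0 (mulr_ge0 (f0 a) (f0 b)) (pos a b).
by congr (0 <= _); rewrite !exprS; ring.
Qed.

(** Jensen's inequality with denominators cleared; each induction step is one use of Chebyshev's
    inequality. *)
Lemma weighted_power_mean (C : numDomainType) (T : finType) (f p : T -> C) n :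
    (forall a, 0 <= f a) -> (forall a, 0 <= p a) ->
  (\sum_a f a * p a) ^+ n.+1 <= (\sum_a f a) ^+ n * (\sum_a f a * p a ^+ n.+1).
Proof.
move=> f0 p0; elim: n => [|n IHn]; first by rewrite expr0 mul1r.
have S1_ge0 : 0 <= \sum_a f a * p a.
  by apply: sumr_ge0 => a _; apply: mulr_ge0.
rewrite exprS; apply: le_trans (ler_wpM2l S1_ge0 IHn) _.
rewrite mulrCA exprSr -mulrA ler_wpM2l ?exprn_ge0 ?sumr_ge0 //.
exact: weighted_chebyshev.
Qed.

(** * The mass of right angles for a weight on a sphere *)

Section RightAngles.
Variables (C : numDomainType) (F : finFieldType) (k : nat).
Let d := (k + k)%N.
Hypothesis nz2 : 2%:R != 0 :> F.
Variables (f : 'rV[F]_d -> C) (r : F) (K : C).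
Hypotheses (r0 : r != 0) (f_ge0 : forall a, 0 <= f a).
Hypothesis f_leK : forall a, f a <= K.
Hypothesis f_supp : forall a, sqnorm a != r -> f a = 0.

Let q : C := #|F|%:R.
Let mass := \sum_a f a.

Definition orthomass c a := \sum_b f b * (dot (a - c) (b - c) == 0)%:R.

Let K_ge0 : 0 <= K. Proof. exact: le_trans (f_ge0 0) (f_leK 0). Qed.
Let q_ge0 : 0 <= q. Proof. exact: ler0n. Qed.
Let mass_ge0 : 0 <= mass. Proof. exact: sumr_ge0. Qed.

Lemma orthomass_ge0 c a : 0 <= orthomass c a.
Proof. by apply: sumr_ge0 => b _; rewrite mulr_ge0. Qed.

Lemma orthomass_le c a : orthomass c a <= mass.
Proof.
apply: ler_sum => b _; rewrite -[leRHS]mulr1 ler_wpM2l //.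
by case: eqP; rewrite ?ler01.
Qed.

(** Read as a condition on [U], membership splits into two conditions when a vector is added to
    [U]. *)
Lemma orthoflatP m (U : 'M[F]_(m, d)) c a :
  (a \in orthoflat U c) = (U <= kermx (a - c)^T)%MS.
Proof. by rewrite inE sub_kermx -(inj_eq trmx_inj) trmx_mul trmxK trmx0. Qed.

Lemma sum_orthoflat_le (U : 'M[F]_d) c : \rank U = k ->
  q * (\sum_(a in orthoflat U c) f a) <= 2%:R * (K * q ^+ k).
Proof.
move=> rkU.
have := card_sphere_affine erefl nz2 rkU c r0.
rewrite -(ler_nat C) !natrM natrX -/q => le_card.
apply: le_trans (_ : q * (#|orthoflat U c :&: sphere d r|%:R * K) <= _).
  rewrite ler_wpM2l // mulr_natl -sumr_const.
  rewrite big_mkcond [leRHS]big_mkcond /=; apply: ler_sum => a _.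
  rewrite !inE; case: eqP => //= _.
  by case: eqP => [//|/eqP/f_supp ->].
by rewrite mulrA mulrCA [leRHS]mulrC ler_wpM2r // mulrC.
Qed.

(* The j factors [orthomass] pick j points b.  A point b with b - c outside U
   raises the rank of U, which has to reach k; there are few b with b - c in U,
   and for those the remaining factors are bounded trivially. *)
Lemma sum_orthomass_exp c j (U : 'M[F]_d) : (\rank U + j)%N = k ->
  q * (\sum_(a in orthoflat U c) f a * orthomass c a ^+ j)
    <= (j + 2)%:R * (K * q ^+ k) * mass ^+ j.
Proof.
elim: j U => [|j IHj] U rkU.
  rewrite addn0 in rkU; rewrite expr0 mulr1 add0n.
  by under eq_bigr do rewrite mulr1; apply: sum_orthoflat_le.
pose V b := (U + (b - c))%MS.
have split_b : \sum_(a in orthoflat U c) f a * orthomass c a ^+ j.+1 =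
    \sum_b f b * \sum_(a in orthoflat U c)
       f a * orthomass c a ^+ j * (dot (a - c) (b - c) == 0)%:R.
  under eq_bigr => a _ do rewrite exprSr mulrA {2}/orthomass mulr_sumr.
  rewrite exchange_big; apply: eq_bigr => b _; rewrite mulr_sumr.
  by apply: eq_bigr => a _; rewrite mulrCA.
have inner b : q * (f b * \sum_(a in orthoflat U c)
       f a * orthomass c a ^+ j * (dot (a - c) (b - c) == 0)%:R) <=
    (if (b - c <= U)%MS then q * (K * mass ^+ j.+1) else 0)
    + f b * ((j + 2)%:R * (K * q ^+ k) * mass ^+ j).
  case: ifPn => bU.
    rewrite -[leLHS]addr0 lerD //; last first.
      by rewrite !mulr_ge0 ?exprn_ge0.
    rewrite ler_wpM2l //.
    apply: le_trans (ler_wpM2r _ (f_leK b)) _.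
      by apply: sumr_ge0 => a _; rewrite !mulr_ge0 ?exprn_ge0 ?orthomass_ge0.
    rewrite ler_wpM2l // exprS mulr_suml big_mkcond /=; apply: ler_sum => a _.
    have le1 : f a * orthomass c a ^+ j <= f a * mass ^+ j.
      by rewrite ler_wpM2l // lerXn2r ?nnegrE ?orthomass_ge0 ?orthomass_le.
    case: ifP => _; last by rewrite mulr_ge0 ?exprn_ge0.
    case: eqP => _; rewrite ?mulr1 ?mulr0 //.
    by rewrite mulr_ge0 ?exprn_ge0.
  rewrite add0r mulrCA ler_wpM2l //.
  apply: le_trans (IHj (V b) _).
    rewrite ler_wpM2l // big_mkcond [leRHS]big_mkcond /=; apply: ler_sum => a _.
    rewrite !orthoflatP addsmx_sub; case: ifP => //= _.
    have -> : (b - c <= kermx (a - c)^T)%MS = (dot (a - c) (b - c) == 0).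
      rewrite sub_kermx dotC; apply/eqP/eqP => [h|h]; first by rewrite /dot h mxE.
      by apply/matrixP => i i'; rewrite !ord1 [LHS]h mxE.
    by case: eqP; rewrite ?mulr1 ?mulr0.
  rewrite -rkU addnS -addSn; congr (_ + _)%N; apply/eqP; rewrite eqn_leq.
  apply/andP; split.
    apply: leq_trans (mxrank_adds_leqif _ _) _.
    by apply: leq_trans (leq_add (leqnn _) (rank_leq_row _)) _; rewrite addn1.
  by apply: rank_ltmx; rewrite ltmxE addsmxSl addsmx_sub submx_refl.
rewrite split_b mulr_sumr; apply: le_trans (ler_sum _ (fun b _ => inner b)) _.
rewrite big_split /= -mulr_suml -/mass -big_mkcond /= sumr_const.
have -> : #|[pred b | (b - c <= U)%MS]| = (#|F| ^ \rank U)%N.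
  by rewrite -(card_coset_submx U c); apply: eq_card => b; rewrite !inE.
have -> : (j.+1 + 2)%:R * (K * q ^+ k) * mass ^+ j.+1 =
    q ^+ k * (K * mass ^+ j.+1)
    + mass * ((j + 2)%:R * (K * q ^+ k) * mass ^+ j).
  by rewrite exprS addSn -natr1; ring.
rewrite lerD2r -mulr_natl natrX mulrA ler_wpM2r //.
  by rewrite mulr_ge0 ?exprn_ge0.
(* Since [\rank U < k], the points with [b - c] in [U] cost at most one more [K * q ^+ k]; this
   raises [j + 2] by one. *)
rewrite -exprSr ler_weXn2l //; first by rewrite ler1n; apply/card_gt0P; exists 0.
by rewrite -rkU addnS ltnS leq_addr.
Qed.

(** The power mean is applied over [a] for fixed [c], with [U = 0] so that the flat is the whole
    space, and then over [c]. The exponents of the mass add up to (k - 1) + (k - 1) + k + 1 = 3k -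
    1. *)
Lemma right_angle_mass : (0 < k)%N ->
  q * (\sum_c f c * \sum_a f a * orthomass c a) ^+ k
    <= (k + 2)%:R * (K * q ^+ k) * mass ^+ (3 * k).-1.
Proof.
move=> k_gt0.
have [k' kE] : exists k', k = k'.+1 by exists k.-1; rewrite prednK.
have W_ge0 c : 0 <= \sum_a f a * orthomass c a.
  by apply: sumr_ge0 => a _; rewrite mulr_ge0 ?orthomass_ge0.
have Wc c : q * (\sum_a f a * orthomass c a) ^+ k
    <= mass ^+ k' * ((k + 2)%:R * (K * q ^+ k) * mass ^+ k).
  have := @sum_orthomass_exp c k 0; rewrite mxrank0 add0n => /(_ erefl) h.
  have pm := weighted_power_mean k' f_ge0 (orthomass_ge0 c).
  rewrite {1}kE; apply: le_trans (ler_wpM2l q_ge0 pm) _.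
  rewrite mulrCA ler_wpM2l ?exprn_ge0 // -kE; apply: le_trans h.
  rewrite ler_wpM2l // [leRHS]big_mkcond /=; apply: ler_sum => a _.
  by rewrite inE trmx0 mulmx0 eqxx.
have pm := weighted_power_mean k' f_ge0 W_ge0.
rewrite {1}kE; apply: le_trans (ler_wpM2l q_ge0 pm) _.
rewrite mulrCA mulr_sumr.
apply: le_trans (_ : mass ^+ k' *
  \sum_c f c * (mass ^+ k' * ((k + 2)%:R * (K * q ^+ k) * mass ^+ k)) <= _).
  rewrite ler_wpM2l ?exprn_ge0 //; apply: ler_sum => c _.
  by rewrite mulrCA ler_wpM2l // -kE.
rewrite -mulr_suml -/mass; apply: eq_ler.
have -> : ((3 * k).-1 = k' + k' + k + 1)%N.
  by rewrite {1}kE !mulnS /= kE; lia.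
by rewrite !exprD expr1; ring.
Qed.
End RightAngles.

(** * Additive characters, Plancherel and Cauchy-Schwarz *)

Lemma exists_additive_character (F : finFieldType) :
  exists psi : F -> algC, [/\ forall x y, psi (x + y) = psi x * psi y,
    forall x, `|psi x| = 1 & exists x, psi x != 1].
Proof.
pose G := [set: F]%G.
have abG : abelian G by apply: FinRing.zmod_abelian.
have : (1 < #|Iirr G|)%N by rewrite card_Iirr_abelian // cardsT finNzRing_gt1.
(* Index 0 is the principal character, so index 1 is a nontrivial irreducible one; it is linear
   because the group is abelian. *)
rewrite card_ord => lt1N; pose i : Iirr G := Ordinal lt1N.
have lin_i : 'chi_i \is a linear_char by apply: (char_abelianP _ abG).
exists 'chi_i; split => [x y|x|].
- by rewrite -(lin_charM lin_i) ?inE.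
- by rewrite (normC_lin_char lin_i) ?inE.
apply/existsP; apply: contraT; rewrite negb_exists => /forallP h.
suff /irr_inj : 'chi_i = 'chi_0 by [].
apply/cfunP => x; rewrite irr0 cfun1E inE; apply/eqP.
by have := h x; rewrite negbK.
Qed.

Section Plancherel.
Variables (X Y : finType) (e : X -> Y -> algC) (n : algC).
Hypothesis e_orth :
  forall x x', \sum_y e x y * (e x' y)^* = n * (x == x')%:R.

(** An arbitrary orthogonal kernel is allowed because vector and scalar frequencies, with either
    sign, all occur below. *)
Lemma plancherel (c : X -> algC) :
  \sum_y `|\sum_x c x * e x y| ^+ 2 = n * \sum_x `|c x| ^+ 2.
Proof.
under eq_bigr => y _.
  rewrite normCK rmorph_sum big_distrlr /=.
  under eq_bigr => x _ do under eq_bigr => x' _ do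
    rewrite rmorphM mulrACA.
  over.
rewrite exchange_big mulr_sumr /=; apply: eq_bigr => x _.
rewrite exchange_big (bigD1 x) //= -mulr_sumr e_orth eqxx mulr1 big1 ?addr0.
  by rewrite mulrC -normCK.
move=> x' x'x; rewrite -mulr_sumr e_orth eq_sym (negbTE x'x).
by rewrite !mulr0.
Qed.

End Plancherel.

Lemma cauchy_schwarz_card (T : finType) (A : {set T}) (u : T -> algC) :
  `|\sum_(x in A) u x| ^+ 2 <= #|A|%:R * \sum_(x in A) `|u x| ^+ 2.
Proof.
pose f x : algC := (x \in A)%:R; pose p x : algC := `|u x|.
have f0 x : 0 <= f x by rewrite /f ler0n.
have p0 x : 0 <= p x by rewrite /p.
have fE (v : T -> algC) : \sum_(x in A) v x = \sum_x f x * v x.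
  rewrite big_mkcond; apply: eq_bigr => x _; rewrite /f.
  by case: (x \in A); rewrite ?mul1r ?mul0r.
have := weighted_power_mean 1 f0 p0; rewrite expr1 -!fE.
rewrite -sum1_card natr_sum (fE (fun=> 1%:R)).
under [X in _ -> _ <= X * _]eq_bigr do rewrite mulr1.
by apply: le_trans; rewrite lerXn2r ?nnegrE ?sumr_ge0 ?ler_norm_sum.
Qed.

(** * Character sums and Gauss sums *)

Section Characters.
Variables (F : finFieldType) (psi : F -> algC).
Hypothesis nz2 : 2%:R != 0 :> F.
Hypotheses (psiD : forall x y, psi (x + y) = psi x * psi y)
  (psi_norm : forall x, `|psi x| = 1) (psi_nontriv : exists x, psi x != 1).

Let q : algC := #|F|%:R.

Lemma psi_neq0 x : psi x != 0.
Proof. by rewrite -normr_eq0 psi_norm oner_eq0. Qed.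

Lemma psi0 : psi 0 = 1.
Proof. by apply: (mulfI (psi_neq0 0)); rewrite -psiD addr0 mulr1. Qed.

Lemma psiN x : psi (- x) = (psi x)^*.
Proof.
apply: (mulfI (psi_neq0 x)); rewrite -psiD subrr psi0.
by rewrite -normCK psi_norm expr1n.
Qed.

Lemma psi_sum (I : finType) (g : I -> F) : psi (\sum_i g i) = \prod_i psi (g i).
Proof. exact: (big_morph _ psiD psi0). Qed.

(** Translation by [x0] multiplies the sum by [psi (h x0)], which differs from 1. *)
Lemma sum_psi_linear (V : finZmodType) (h : V -> F) :
  (forall x y, h (x + y) = h x + h y) -> (exists x, psi (h x) != 1) ->
  \sum_x psi (h x) = 0.
Proof.
move=> hD [x0 hx0]; set S := \sum_x _.
have SE : S = psi (h x0) * S.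
  rewrite {1}/S (reindex_inj (addrI x0)) mulr_sumr /=.
  by apply: eq_bigr => x _; rewrite hD psiD.
apply/eqP; move: hx0; apply: contraR => S0.
by rewrite -(inj_eq (mulIf S0)) mul1r -SE.
Qed.

Lemma sum_psi_mul s : \sum_x psi (s * x) = q * (s == 0)%:R.
Proof.
have [->|s0] := eqVneq; rewrite ?mulr1 ?mulr0.
  by under eq_bigr do rewrite mul0r psi0; rewrite sumr_const -/q.
apply: sum_psi_linear => [x y|]; first by rewrite mulrDr.
by have [x hx] := psi_nontriv; exists (x / s); rewrite mulrC divfK.
Qed.

Lemma sum_psi_dot d (y : 'rV[F]_d) :
  \sum_x psi (dot x y) = q ^+ d * (y == 0)%:R.
Proof.
have [->|y0] := eqVneq; rewrite ?mulr1 ?mulr0.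
  under eq_bigr do rewrite dot0r psi0.
  by rewrite sumr_const card_mx mul1n natrX -/q.
apply: sum_psi_linear => [x x'|]; first by rewrite dotDl.
have [x hx] := psi_nontriv; have [j yj] := rV0Pn _ y0.
exists ((x / y 0 j) *: delta_mx 0 j); rewrite dotZl /dot -rowE.
by rewrite !mxE divfK.
Qed.

Lemma orth_psi_dot d (x x' : 'rV[F]_d) :
  \sum_y psi (dot x y) * (psi (dot x' y))^* = q ^+ d * (x == x')%:R.
Proof.
rewrite -subr_eq0 -sum_psi_dot; apply: eq_bigr => y _.
by rewrite -psiN -psiD -dotBl dotC.
Qed.

Lemma orth_psi_mul (x x' : F) :
  \sum_y psi (x * y) * (psi (x' * y))^* = q * (x == x')%:R.
Proof.
rewrite -subr_eq0 -sum_psi_mul; apply: eq_bigr => y _.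
by rewrite -psiN -psiD -mulrBl.
Qed.

Definition gauss d (u : F) := \sum_(m : 'rV[F]_d) psi (u * sqnorm m).

(** Substituting [h + n] for the first variable cancels the phase quadratic in [n]; the sum over [n]
    of the remaining linear phase vanishes unless [h = 0]. *)
Lemma gauss_norm d u : u != 0 -> `|gauss d u| ^+ 2 = q ^+ d.
Proof.
move=> u0; rewrite normCK rmorph_sum mulr_sumr /=.
under eq_bigr => n _.
  rewrite mulr_suml (reindex_inj (addIr n)) /=.
  under eq_bigr => h _.
    rewrite -psiN -psiD sqnormD.
    have -> : u * (sqnorm h + 2%:R * dot h n + sqnorm n) + - (u * sqnorm n)
      = u * sqnorm h + dot n ((2%:R * u) *: h) by rewrite dotZr (dotC n); ring.
    rewrite psiD; over.
  over.
rewrite exchange_big (bigD1 0) //= -mulr_sumr sum_psi_dot scaler0 eqxx mulr1.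
rewrite sqnorm0 mulr0 psi0 mul1r.
rewrite big1 ?addr0 // => h h0; rewrite -mulr_sumr sum_psi_dot.
rewrite scaler_eq0 (negbTE h0) orbF mulf_eq0 (negbTE nz2) (negbTE u0).
by rewrite !mulr0.
Qed.

Let sq1 (u : F) := \sum_x psi (u * x ^+ 2).

Lemma gaussE d u : gauss d u = sq1 u ^+ d.
Proof.
rewrite -[in RHS](card_ord d) -prodr_const bigA_distr_bigA /=.
rewrite /gauss (reindex (fun g : {ffun 'I_d -> F} => \row_i g i)) /=.
  apply: eq_bigr => g _; rewrite /sqnorm mulr_sumr psi_sum.
  by apply: eq_bigr => i _; rewrite mxE.
exists (fun m : 'rV[F]_d => [ffun i => m 0 i]) => m _.
  by apply/ffunP => i; rewrite ffunE mxE.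
by apply/rowP => i; rewrite mxE ffunE.
Qed.

(* For u not a square, each nonzero v is hit twice in total by x^2 and u x^2:
   the counts are at most 2 and average to 2. *)
Lemma sq1_sqr u : u != 0 -> sq1 u ^+ 2 = sq1 1 ^+ 2.
Proof.
move=> u0.
have [/existsP[w /eqP uw] | /existsPn nsq] := boolP [exists w, w ^+ 2 == u].
  have w0 : w != 0 by apply: contraNneq u0 => w0; rewrite -uw w0 expr0n.
  congr (_ ^+ 2); rewrite /sq1 [RHS](reindex_inj (mulfI w0)) /=.
  by apply: eq_bigr => x _; rewrite mul1r exprMn uw.
suff /eqP : sq1 1 + sq1 u = 0 by rewrite addr_eq0 => /eqP ->; rewrite sqrrN.
pose c w v := #|[set x : F | (w * x ^+ 2 == v)%R]|.
have sq1E w : sq1 w = \sum_v (c w v)%:R * psi v.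
  rewrite /sq1 (partition_big (fun x => w * x ^+ 2) predT) //=.
  apply: eq_bigr => v _; rewrite mulr_natl -sumr_const.
  by apply: eq_big => [x|x /eqP ->] //; rewrite inE.
have c_le2 w v : w != 0 -> (c w v <= 2)%N.
  move=> w0; have := @card_quadratic_roots F w 0 (- v); rewrite w0 => /(_ isT).
  apply: leq_trans; apply/subset_leq_card/subsetP => x; rewrite !inE.
  by rewrite mul0r addr0 subr_eq0.
have c_le v : v != 0 -> (c 1%R v + c u v <= 2)%N.
  move=> v0; have [c1|] := posnP (c 1%R v); first by rewrite c1 c_le2.
  move=> /card_gt0P[x]; rewrite inE mul1r => /eqP xv.
  suff -> : c u v = 0%N by rewrite addn0 c_le2 ?oner_eq0.
  apply: eq_card0 => y; rewrite inE; apply/negP => /eqP yv.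
  have y0 : y != 0 by apply: contraNneq v0 => y0; rewrite -yv y0 expr0n mulr0.
  move: (nsq (x / y)); rewrite expr_div_n xv -yv mulfK ?eqxx //.
  by rewrite expf_neq0.
have c0 w : w != 0 -> c w 0 = 1%N.
  move=> w0; rewrite -(cards1 (0 : F)); apply: eq_card => x.
  by rewrite !inE mulf_eq0 (negbTE w0) expf_eq0.
have sumc w : (\sum_v c w v = #|F|)%N.
  rewrite -sum1_card [RHS](partition_big (fun x => w * x ^+ 2)%R predT) //=.
  apply: eq_bigr => v _; rewrite /c -sum1_card.
  by apply: eq_bigl => x; rewrite inE.
have {}c_le v : (c 1%R v + c u v <= 2)%N.
  by have [->|/c_le//] := eqVneq v 0; rewrite !c0 ?oner_eq0.
have c_eq v : (c 1%R v + c u v = 2)%N.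
  have [_] := leqif_sum (fun v (_ : predT v) => leqif_geq (c_le v)).
  rewrite big_split /= !sumc sum_nat_const muln2 addnn eqxx.
  move=> /esym/forallP/(_ v)/= le2; apply/eqP.
  by rewrite eqn_leq c_le.
rewrite !sq1E -big_split /=.
transitivity (2%:R * \sum_v psi (1 * v)); last first.
  by rewrite sum_psi_mul oner_eq0 !mulr0.
by rewrite mulr_sumr; apply: eq_bigr => v _; rewrite -mulrDl -natrD c_eq mul1r.
Qed.

(** In dimension [k + k] the Gauss sum is a power of [sq1 u ^+ 2], which no longer sees whether [u]
    is a square. *)
Lemma gauss_const k u : u != 0 -> gauss (k + k) u = gauss (k + k) 1.
Proof. by move=> u0; rewrite !gaussE addnn -mul2n !exprM sq1_sqr. Qed.

(* Completing the square. *)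
Lemma psi_sqnorm_fourier d s (y : 'rV[F]_d) : s != 0 ->
  let u := - (4%:R * s)^-1 in
  gauss d u * psi (s * sqnorm y) =
  \sum_m psi (u * sqnorm m) * psi (- dot m y).
Proof.
move=> s0 u; rewrite mulr_suml (reindex_inj (addIr ((2%:R * s) *: y))) /=.
apply: eq_bigr => m _; rewrite -!psiD sqnormD sqnormZ dotZr; congr psi.
have nz4 : 4%:R != 0 :> F by rewrite (natrM _ 2 2) mulf_neq0.
rewrite /u; field.
by rewrite s0 nz4.
Qed.
End Characters.

(** * Fourier restriction to spheres *)

Section Restriction.
Variables (F : finFieldType) (psi : F -> algC).
Hypothesis nz2 : 2%:R != 0 :> F.
Hypotheses (psiD : forall x y, psi (x + y) = psi x * psi y)
  (psi_norm : forall x, `|psi x| = 1) (psi_nontriv : exists x, psi x != 1).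

Let q : algC := #|F|%:R.

Lemma plancherel_rV d (w : 'rV[F]_d -> algC) :
  \sum_x `|\sum_m w m * psi (- dot m x)| ^+ 2 = q ^+ d * \sum_m `|w m| ^+ 2.
Proof.
apply: plancherel => m m'; rewrite -(inj_eq oppr_inj).
rewrite -(orth_psi_dot psiD psi_norm psi_nontriv).
by apply: eq_bigr => x _; rewrite !dotNl.
Qed.

(** The square of the exponential sum has the self-convolution [v] of [w] as coefficients.
    Plancherel leaves the square sum of [v], and [z = a + b] turns it into a sum over additive
    quadruples. *)
Lemma fourth_moment_le d (w : 'rV[F]_d -> algC) :
  \sum_x `|\sum_m w m * psi (- dot m x)| ^+ 4 <=
  q ^+ d * \sum_c \sum_a \sum_b `|w c| * (`|w a| * (`|w b| * `|w (a + b - c)|)).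
Proof.
pose v z := \sum_a w a * w (z - a).
have sqE x : (\sum_m w m * psi (- dot m x)) ^+ 2 = \sum_z v z * psi (- dot z x).
  rewrite expr2 big_distrlr /=.
  under [RHS]eq_bigr do rewrite mulr_suml.
  rewrite [RHS]exchange_big; apply: eq_bigr => a _.
  rewrite [RHS](reindex_inj (addrI a)); apply: eq_bigr => b _.
  by rewrite addrAC subrr add0r mulrACA -psiD -opprD -dotDl.
under eq_bigr => x _ do rewrite (exprM _ 2 2) -normrX sqE.
rewrite plancherel_rV ler_wpM2l ?exprn_ge0 ?ler0n //.
have vE z : `|v z| ^+ 2 <=
    \sum_c \sum_a `|w c| * (`|w a| * (`|w (z - a)| * `|w (z - c)|)).
  have le1 : `|v z| <= \sum_a `|w a| * `|w (z - a)|.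
    by apply: le_trans (ler_norm_sum _ _ _) _; under eq_bigr do rewrite normrM.
  have le2 : `|v z| ^+ 2 <= (\sum_a `|w a| * `|w (z - a)|) ^+ 2.
    by rewrite lerXn2r ?nnegrE ?sumr_ge0 // => a _; rewrite mulr_ge0.
  apply: le_trans le2 _; rewrite expr2 big_distrlr /=.
  by apply: ler_sum => c _; apply: ler_sum => a _; apply: eq_ler; ring.
apply: le_trans (ler_sum _ (fun z _ => vE z)) _.
rewrite exchange_big /=; apply: ler_sum => c _.
rewrite exchange_big /=; apply: ler_sum => a _.
rewrite (reindex_inj (addrI a)) /=; apply: ler_sum => b _.
by rewrite addrAC subrr add0r.
Qed.

Section FourierTransform.
Variables (d : nat) (E : {set 'rV[F]_d}).
Let n : algC := #|E|%:R.

Definition hat m := \sum_(x in E) psi (- dot m x).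

Lemma hat_norm_le m : `|hat m| <= n.
Proof.
apply: le_trans (ler_norm_sum _ _ _) _.
by under eq_bigr do rewrite psi_norm; rewrite sumr_const.
Qed.

Lemma hat_plancherel : \sum_m `|hat m| ^+ 2 = q ^+ d * n.
Proof.
have hE m : hat m = \sum_x (x \in E)%:R * psi (- dot x m).
  rewrite /hat big_mkcond; apply: eq_bigr => x _.
  by rewrite (dotC x); case: ifP => _; rewrite ?mul1r ?mul0r.
under eq_bigr do rewrite hE.
rewrite plancherel_rV /n -sum1_card natr_sum [in RHS]big_mkcond; congr (_ * _).
by apply: eq_bigr => x _; case: ifP; rewrite ?normr1 ?normr0 ?expr1n ?expr0n.
Qed.

Definition sphere_mass r := \sum_(m in sphere d r) `|hat m| ^+ 2.

Definition sphere_cube r := \sum_(m in sphere d r) `|hat m| ^+ 3.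

Lemma sphere_mass_ge0 r : 0 <= sphere_mass r.
Proof. by apply: sumr_ge0 => m _; rewrite exprn_ge0. Qed.

Lemma sphere_cube_ge0 r : 0 <= sphere_cube r.
Proof. by apply: sumr_ge0 => m _; rewrite exprn_ge0. Qed.

Lemma sum_sphere (h : 'rV[F]_d -> algC) :
  \sum_r \sum_(m in sphere d r) h m = \sum_m h m.
Proof.
rewrite [RHS](partition_big (fun m => sqnorm m) predT) //=.
by apply: eq_bigr => r _; apply: eq_bigl => m; rewrite inE.
Qed.

Lemma sum_sphere_mass : \sum_r sphere_mass r = q ^+ d * n.
Proof. by rewrite sum_sphere hat_plancherel. Qed.

Lemma sphere_mass_le r : sphere_mass r <= q ^+ d * n.
Proof.
rewrite -sum_sphere_mass (bigD1 r) //= lerDl.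
by apply: sumr_ge0 => s _; apply: sphere_mass_ge0.
Qed.

Lemma sum_sphere_cube : \sum_r sphere_cube r <= q ^+ d * n ^+ 2.
Proof.
rewrite sum_sphere expr2 mulrA -hat_plancherel mulr_suml.
by apply: ler_sum => m _; rewrite exprSr ler_wpM2l ?exprn_ge0 ?hat_norm_le.
Qed.

Definition sphere_weight r m : algC :=
  if m \in sphere d r then `|hat m| ^+ 2 else 0.

Lemma sphere_weight_ge0 r m : 0 <= sphere_weight r m.
Proof. by rewrite /sphere_weight; case: ifP; rewrite ?exprn_ge0. Qed.

Lemma sphere_weight_le r m : sphere_weight r m <= n ^+ 2.
Proof.
rewrite /sphere_weight; case: ifP => _; last by rewrite exprn_ge0 ?ler0n.
by rewrite lerXn2r ?nnegrE ?ler0n ?hat_norm_le.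
Qed.

Lemma sum_sphere_weight r : \sum_m sphere_weight r m = sphere_mass r.
Proof. by rewrite -big_mkcond. Qed.

(** Duality: [w m * hat m] is the cube of [|hat m|] on the sphere, so the cube sum is the sum of [H]
    over [E]. Two uses of Cauchy-Schwarz over [E] give [n ^+ 3] times the fourth moment of [H]. *)
Lemma sphere_cube_pow4 r : sphere_cube r ^+ 4 <= n ^+ 3 * (q ^+ d *
  \sum_c \sum_a \sum_b sphere_weight r c * (sphere_weight r a *
    (sphere_weight r b * sphere_weight r (a + b - c)))).
Proof.
pose w m : algC := if m \in sphere d r then `|hat m| * (hat m)^* else 0.
have wE m : `|w m| = sphere_weight r m.
  rewrite /w /sphere_weight; case: ifP; rewrite ?normr0 // => _.
  by rewrite normrM norm_conjC normr_id expr2.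
pose H x := \sum_m w m * psi (- dot m x).
have cubeE : sphere_cube r = \sum_(x in E) H x.
  rewrite exchange_big /= /sphere_cube big_mkcond; apply: eq_bigr => m _.
  rewrite -mulr_sumr -/(hat m) /w; case: ifP; rewrite ?mul0r // => _.
  by rewrite -mulrA -normCKC exprS.
have n0 : 0 <= n by apply: ler0n.
have H2 : 0 <= \sum_(x in E) `|H x| ^+ 2.
  by apply: sumr_ge0 => x _; rewrite exprn_ge0.
have cs1 := cauchy_schwarz_card E H.
rewrite -cubeE ger0_norm ?sphere_cube_ge0 // in cs1.
have cs2 := cauchy_schwarz_card E (fun x => `|H x| ^+ 2).
rewrite ger0_norm // in cs2.
rewrite (exprM _ 2 2).
apply: le_trans (_ : (n * \sum_(x in E) `|H x| ^+ 2) ^+ 2 <= _).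
  by rewrite lerXn2r ?nnegrE ?mulr_ge0 ?exprn_ge0 ?sphere_cube_ge0.
rewrite exprMn [n ^+ 3]exprSr -mulrA ler_wpM2l ?exprn_ge0 //.
apply: le_trans cs2 _; rewrite ler_wpM2l //.
have := fourth_moment_le w; rewrite -/H.
under [X in _ <= _ * X -> _]eq_bigr => c _ do under eq_bigr => a _ do
  under eq_bigr => b _ do rewrite !wE.
apply: le_trans; rewrite big_mkcond /=; apply: ler_sum => x _.
rewrite normrX normr_id -exprM; case: ifP => // _; exact: exprn_ge0.
Qed.
End FourierTransform.

(** * The restriction estimate in even dimension *)

Section EvenDimension.
Variables (k : nat) (E : {set 'rV[F]_(k + k)}).
Hypothesis k_gt0 : (0 < k)%N.
(** For d = 2k this is a lower bound on the size of [E] with exponent (4k^2 + k - 1)/(4k - 1) =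
    (d+1)/2 - 1/(4d-2) of [q]. *)
Hypothesis cardE :
  ((k + 2) * #|F| ^ (4 * k ^ 2 + k).-1 <= #|E| ^ (4 * k).-1)%N.
Let n : algC := #|E|%:R.

(** A nonzero term has all four points on the sphere, so they form a rectangle; the fourth weight is
    then bounded by [n ^+ 2]. *)
Lemma additive_quadruples_le r :
  \sum_c \sum_a \sum_b sphere_weight E r c * (sphere_weight E r a *
    (sphere_weight E r b * sphere_weight E r (a + b - c)))
  <= n ^+ 2 * \sum_c sphere_weight E r c *
       \sum_a sphere_weight E r a * orthomass (sphere_weight E r) c a.
Proof.
set f := sphere_weight E r.
have f0 m : 0 <= f m by apply: sphere_weight_ge0.
have supp m : f m != 0 -> sqnorm m = r.
  rewrite /f /sphere_weight inE; by case: (sqnorm m =P r) => // _; rewrite eqxx.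
rewrite mulr_sumr; apply: ler_sum => c _.
rewrite !mulr_sumr; apply: ler_sum => a _.
rewrite /orthomass !mulr_sumr; apply: ler_sum => b _.
have [->|/supp fc] := eqVneq (f c) 0; first by rewrite !mul0r mulr0.
have [->|/supp fa] := eqVneq (f a) 0; first by rewrite !(mul0r, mulr0).
have [->|/supp fb] := eqVneq (f b) 0; first by rewrite !(mul0r, mulr0).
rewrite [leRHS]mulrCA ler_wpM2l // [leRHS]mulrCA ler_wpM2l //.
rewrite [leRHS]mulrCA ler_wpM2l //.
have [->|/supp fd] := eqVneq (f (a + b - c)) 0.
  by rewrite mulr_ge0 ?exprn_ge0 ?ler0n.
rewrite (inscribed_parallelogram_rectangle nz2 fa fb fc fd) eqxx mulr1.
exact: sphere_weight_le.
Qed.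

(** Both sides are raised to the power [2 * k], so that [M4] enters to the power [k] and meets
    [Wk]. *)
Lemma sphere_cube_sqr r : r != 0 ->
  q * sphere_cube E r ^+ 2 <= n ^+ 5 * sphere_mass E r.
Proof.
move=> r0; set M := sphere_cube E r; set Fr := sphere_mass E r.
have q_gt0 : 0 < q by rewrite ltr0n; apply/card_gt0P; exists 0.
have q0 := ltW q_gt0; have n0 : 0 <= n by apply: ler0n.
have M0 : 0 <= M by apply: sphere_cube_ge0.
have Fr0 : 0 <= Fr by apply: sphere_mass_ge0.
set W := \sum_c sphere_weight E r c *
       \sum_a sphere_weight E r a * orthomass (sphere_weight E r) c a.
have W0 : 0 <= W.
  apply: sumr_ge0 => c _; rewrite mulr_ge0 ?sphere_weight_ge0 //.
  apply: sumr_ge0 => a _; rewrite mulr_ge0 ?sphere_weight_ge0 //.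
  by apply: orthomass_ge0 => b; apply: sphere_weight_ge0.
have M4 : M ^+ 4 <= n ^+ 5 * q ^+ (k + k) * W.
  apply: le_trans (sphere_cube_pow4 _ _) _; rewrite -/n -/q.
  apply: le_trans (_ : n ^+ 3 * (q ^+ (k + k) * (n ^+ 2 * W)) <= _).
    by rewrite !ler_wpM2l ?exprn_ge0 // additive_quadruples_le.
  by apply: eq_ler; ring.
have Wk : q * W ^+ k <= (k + 2)%:R * (n ^+ 2 * q ^+ k) * Fr ^+ (3 * k).-1.
  have := right_angle_mass nz2 r0 (sphere_weight_ge0 E r) (sphere_weight_le E r).
  rewrite sum_sphere_weight; apply => // a ar.
  by rewrite /sphere_weight inE (negbTE ar).
have hn : (k + 2)%:R * q ^+ (4 * k ^ 2 + k).-1 <= n ^+ (4 * k).-1.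
  by move: cardE; rewrite -(ler_nat algC) natrM !natrX.
have FrQ : Fr <= q ^+ (k + k) * n by apply: sphere_mass_le.
have k2_gt0 : (0 < 2 * k)%N by rewrite muln_gt0.
rewrite -(ler_pXn2r k2_gt0) ?nnegrE ?mulr_ge0 ?exprn_ge0 //.
have -> : (q * M ^+ 2) ^+ (2 * k) = q ^+ (2 * k).-1 * (q * (M ^+ 4) ^+ k).
  rewrite mulrA -exprSr prednK // exprMn -!exprM; congr (_ * _ ^+ _).
  clear -k_gt0; lia.
apply: le_trans (_ : q ^+ (2 * k).-1 *
  (q * ((n ^+ 5 * q ^+ (k + k)) ^+ k * W ^+ k)) <= _).
  rewrite !ler_wpM2l ?exprn_ge0 // -exprMn lerXn2r ?nnegrE //.
    by rewrite exprn_ge0.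
  by rewrite !mulr_ge0 ?exprn_ge0.
rewrite (mulrCA q); apply: le_trans (_ : q ^+ (2 * k).-1 *
  ((n ^+ 5 * q ^+ (k + k)) ^+ k *
   ((k + 2)%:R * (n ^+ 2 * q ^+ k) * Fr ^+ (3 * k).-1)) <= _).
  by rewrite !ler_wpM2l ?exprn_ge0 ?mulr_ge0 ?exprn_ge0.
(* Of the 3k - 1 factors [Fr], 2k match the right-hand side and k - 1 are bounded by the total
   mass. *)
have -> : Fr ^+ (3 * k).-1 = Fr ^+ k.-1 * Fr ^+ (2 * k).
  by rewrite -exprD; congr (_ ^+ _); clear -k_gt0; lia.
apply: le_trans (_ : q ^+ (2 * k).-1 *
  ((n ^+ 5 * q ^+ (k + k)) ^+ k *
   ((k + 2)%:R * (n ^+ 2 * q ^+ k) *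
     ((q ^+ (k + k) * n) ^+ k.-1 * Fr ^+ (2 * k)))) <= _).
  rewrite !ler_wpM2l ?exprn_ge0 ?mulr_ge0 ?exprn_ge0 ?ler0n //.
  rewrite ler_wpM2r ?exprn_ge0 // lerXn2r ?nnegrE ?mulr_ge0 ?exprn_ge0 //.
rewrite [leRHS]exprMn !mulrA ler_wpM2r ?exprn_ge0 // -exprM.
apply: le_trans
  (_ : (k + 2)%:R * q ^+ (4 * k ^ 2 + k).-1 * n ^+ (6 * k + 1) <= _).
  apply: eq_ler.
  have -> : ((4 * k ^ 2 + k).-1 =
      (2 * k).-1 + (k + k) * k + k + (k + k) * k.-1)%N.
    by clear -k_gt0; case: k k_gt0 => // k' _; rewrite expnS expn1 /=; nia.
  have -> : (6 * k + 1 = k + k + k + k + k + 2 + k.-1)%N by clear -k_gt0; lia.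
  rewrite !exprD !exprM !(exprD, exprMn) -!exprM; ring.
(* The size hypothesis trades the power of [q] for n^(4k-1), completing n^(6k+1) to n^(10k). *)
apply: le_trans (ler_wpM2r _ hn) _; first by rewrite exprn_ge0.
by rewrite -exprD; apply: eq_ler; congr (_ ^+ _); clear -k_gt0; lia.
Qed.
End EvenDimension.
End Restriction.

(** * Counting triples by the value of their sum *)

Lemma norm_sqr_add3 (x y z : algC) :
  `|x + y + z| ^+ 2 <= 3%:R * (`|x| ^+ 2 + `|y| ^+ 2 + `|z| ^+ 2).
Proof.
have tri : `|x + y + z| <= `|x| + `|y| + `|z|.
  by apply: le_trans (ler_normD _ _) _; rewrite lerD2r ler_normD.
apply: le_trans (_ : (`|x| + `|y| + `|z|) ^+ 2 <= _).
  by rewrite lerXn2r ?nnegrE ?addr_ge0.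
rewrite -subr_ge0.
have -> : 3%:R * (`|x| ^+ 2 + `|y| ^+ 2 + `|z| ^+ 2) - (`|x| + `|y| + `|z|) ^+ 2
  = (`|x| - `|y|) ^+ 2 + (`|y| - `|z|) ^+ 2 + (`|x| - `|z|) ^+ 2 by ring.
by rewrite !addr_ge0 // real_exprn_even_ge0 // realB ?normr_real.
Qed.

Lemma sum_setX_mul (S T : finType) (A : {set S}) (B : {set T}) (f : S -> algC) h :
  \sum_(p in setX A B) f p.1 * h p.2 = (\sum_(x in A) f x) * (\sum_(y in B) h y).
Proof.
rewrite big_distrlr pair_big /=.
by apply: eq_bigl => -[x y]; rewrite in_setX.
Qed.

Section DualFrequency.
Variable F : finFieldType.
Hypothesis nz2 : 2%:R != 0 :> F.

Let nz4 : 4%:R != 0 :> F. Proof. by rewrite (natrM _ 2 2) mulf_neq0. Qed.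

(** The frequency produced from [s] by completing the square. As [0^-1 = 0], it fixes 0 and is an
    involution of the whole field. *)
Definition dual_freq (s : F) := - (4%:R * s)^-1.

Lemma dual_freqK : involutive dual_freq.
Proof.
by move=> s; rewrite /dual_freq mulrN invrN opprK invfM invrK mulKf.
Qed.

Lemma dual_freq_eq0 s : (dual_freq s == 0) = (s == 0).
Proof. by rewrite oppr_eq0 invr_eq0 mulf_eq0 (negbTE nz4). Qed.

End DualFrequency.

Section Counting.
Variables (F : finFieldType) (psi : F -> algC).
Hypothesis nz2 : 2%:R != 0 :> F.
Hypotheses (psiD : forall x y, psi (x + y) = psi x * psi y)
  (psi_norm : forall x, `|psi x| = 1) (psi_nontriv : exists x, psi x != 1).
Variables (k : nat) (E : {set 'rV[F]_(k + k)}).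

Let q : algC := #|F|%:R.
Let n : algC := #|E|%:R.
Let g := gauss psi (k + k) 1.
Let hatE := hat psi E.

Definition triples := setX (setX E E) E.

Definition tsum (p : 'rV[F]_(k + k) * 'rV[F]_(k + k) * 'rV[F]_(k + k)) :=
  p.1.1 + p.1.2 + p.2.

Definition rep_count t : algC := \sum_(p in triples) (sqnorm (tsum p) == t)%:R.

Definition sphere_sum r := \sum_(m in sphere (k + k) r) hatE m ^+ 3.

Lemma card_triples : #|triples| = (#|E| ^ 3)%N.
Proof. by rewrite !cardsX !expnS expn0; lia. Qed.

Lemma sum_triples_psi m :
  \sum_(p in triples) psi (- dot m (tsum p)) = hatE m ^+ 3.
Proof.
rewrite exprSr expr2 -!sum_setX_mul /=; apply: eq_bigr => p _.
by rewrite -!psiD /tsum -!opprD -!dotDr.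
Qed.

(** Completing the square makes the phase linear, so the triples contribute [hatE m ^+ 3]; the Gauss
    factor is the same [g] for every [s], and the [m] are grouped by radius. *)
Lemma sum_triples_psi_sqnorm s : s != 0 ->
  g * (\sum_(p in triples) psi (s * sqnorm (tsum p))) =
  \sum_r sphere_sum r * psi (dual_freq s * r).
Proof.
move=> s0; have u0 : dual_freq s != 0 by rewrite dual_freq_eq0.
rewrite mulr_sumr /g -(gauss_const psiD psi_norm psi_nontriv k u0).
under eq_bigr => p _ do rewrite psi_sqnorm_fourier // -/(dual_freq s).
rewrite exchange_big /=.
under eq_bigr => m _ do rewrite -mulr_sumr sum_triples_psi mulrC.
rewrite (partition_big (fun m => sqnorm m) predT) //=; apply: eq_bigr => r _.
rewrite mulr_suml; apply: eq_big => [m|m /eqP <-//]; first by rewrite inE.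
Qed.

Lemma sum_psi_neq0 r : \sum_(s | s != 0) psi (s * r) = q * (r == 0)%:R - 1.
Proof.
rewrite -(sum_psi_mul psiD psi_norm psi_nontriv) [in RHS](bigD1 0) //=.
rewrite mulr0 (psi0 psiD psi_norm) addrAC subrr add0r.
by apply: eq_bigr => s _; rewrite mulrC.
Qed.

(** The value at [s = 0] is 0 because that frequency gives just the main term; radius 0 is left out
    because its contribution is explicit. *)
Definition rem_coef s : algC :=
  if s == 0 then 0 else \sum_(r | r != 0) sphere_sum r * psi (dual_freq s * r).

Definition remainder t := \sum_s rem_coef s * psi (- s * t).

Lemma rep_count_expansion t :
  q * g * rep_count t =
  g * n ^+ 3 + sphere_sum 0 * (q * (t == 0)%:R - 1) + remainder t.
Proof.
have qN : q * rep_count t =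
    \sum_s (\sum_(p in triples) psi (s * sqnorm (tsum p))) * psi (- s * t).
  rewrite mulr_sumr; under [RHS]eq_bigr do rewrite mulr_suml.
  rewrite exchange_big; apply: eq_bigr => p _.
  rewrite -subr_eq0 -(sum_psi_mul psiD psi_norm psi_nontriv).
  by apply: eq_bigr => s _; rewrite -psiD; congr psi; ring.
rewrite mulrAC (mulrC _ g) qN mulr_sumr (bigD1 0) //=.
under eq_bigr => p _ do rewrite mul0r (psi0 psiD psi_norm).
rewrite sumr_const card_triples natrX -/n oppr0 mul0r (psi0 psiD psi_norm) mulr1.
rewrite -addrA; congr (_ + _).
have -> : q * (t == 0)%:R - 1 = \sum_(s | s != 0) psi (- s * t).
  rewrite -oppr_eq0 -sum_psi_neq0; apply: eq_bigr => s _.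
  by rewrite mulrN mulNr.
rewrite /remainder [X in _ = _ + X](bigD1 0) //= {1}/rem_coef eqxx mul0r add0r.
rewrite mulr_sumr -big_split /=; apply: eq_bigr => s s0.
rewrite mulrA sum_triples_psi_sqnorm // /rem_coef (negbTE s0).
by rewrite (bigD1 0) //= mulr0 (psi0 psiD psi_norm) mulr1 mulrDl.
Qed.

(** Plancherel in [t] and then in the dual frequency, each costing a factor [q]; the inequality
    comes from filling in the zero frequency, where [rem_coef] vanishes. *)
Lemma remainder_l2 :
  \sum_t `|remainder t| ^+ 2 <= q ^+ 2 * \sum_(r | r != 0) `|sphere_sum r| ^+ 2.
Proof.
have q0 : 0 <= q by apply: ler0n.
rewrite (@plancherel _ _ (fun s t => psi (- s * t)) q); last first.
  by move=> s s'; rewrite (orth_psi_mul psiD psi_norm psi_nontriv) eqr_opp.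
rewrite expr2 -mulrA ler_wpM2l //.
pose c r := if r == 0 then 0 else sphere_sum r.
have -> : \sum_(r | r != 0) `|sphere_sum r| ^+ 2 = \sum_r `|c r| ^+ 2.
  rewrite big_mkcond; apply: eq_bigr => r _; rewrite /c.
  by case: eqP => //=; rewrite normr0 expr0n.
have <- : \sum_u `|\sum_r c r * psi (r * u)| ^+ 2 = q * \sum_r `|c r| ^+ 2.
  rewrite (@plancherel _ _ (fun r u => psi (r * u)) q) // => r r'.
  by rewrite (orth_psi_mul psiD psi_norm psi_nontriv).
rewrite [leRHS](reindex_inj (inv_inj (dual_freqK nz2))) /=; apply: ler_sum => s _.
rewrite /rem_coef; case: eqP => [_|s0].
  by rewrite normr0 expr0n exprn_ge0.
apply: eq_ler; congr (`|_| ^+ 2).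
rewrite big_mkcond; apply: eq_bigr => r _; rewrite /c (mulrC r).
by case: (r == 0) => /=; rewrite ?mul0r.
Qed.

Hypothesis k_gt0 : (0 < k)%N.
Hypothesis cardE :
  ((k + 2) * #|F| ^ (4 * k ^ 2 + k).-1 <= #|E| ^ (4 * k).-1)%N.
Hypothesis cardE12 : (12 * #|F| ^ k <= #|E|)%N.

Let q_gt0 : 0 < q.
Proof. by rewrite ltr0n; apply/card_gt0P; exists 0. Qed.
Let q0 : 0 <= q. Proof. exact: ltW. Qed.
Let n0 : 0 <= n. Proof. exact: ler0n. Qed.

Let n_ge : 12%:R * q ^+ k <= n.
Proof. by move: cardE12; rewrite -(ler_nat algC) natrM natrX. Qed.

Let q2_le_n2 : q ^+ (k + k) <= n ^+ 2.
Proof.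
rewrite addnn -mul2n mulnC exprM lerXn2r ?nnegrE ?exprn_ge0 //.
by apply: le_trans n_ge; rewrite ler_peMl ?exprn_ge0 ?ler1n.
Qed.

Let g_norm2 : `|g| ^+ 2 = q ^+ (k + k).
Proof. exact: gauss_norm (oner_neq0 _). Qed.

Let g_norm : `|g| = q ^+ k.
Proof.
apply/eqP; rewrite -(@eqrXn2 _ 2) ?exprn_ge0 // g_norm2 -exprM.
by rewrite muln2 addnn.
Qed.

Lemma sphere_sum_le r : `|sphere_sum r| <= sphere_cube psi E r.
Proof.
apply: le_trans (ler_norm_sum _ _ _) _.
by under eq_bigr do rewrite normrX.
Qed.

(** The restriction estimate is linear in the sphere mass, so summing it over radii leaves the total
    mass. *)
Lemma remainder_l2_le : \sum_t `|remainder t| ^+ 2 <= q * (q ^+ (k + k) * n ^+ 6).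
Proof.
apply: le_trans remainder_l2 _; rewrite expr2 -mulrA ler_wpM2l //.
apply: le_trans (_ : n ^+ 5 * \sum_r sphere_mass psi E r <= _); last first.
  by rewrite sum_sphere_mass // mulrCA -exprSr.
rewrite !mulr_sumr [leRHS](bigID (fun r => r == 0)) /=.
rewrite -[leLHS]add0r lerD //.
  by apply: sumr_ge0 => r _; rewrite mulr_ge0 ?exprn_ge0 ?sphere_mass_ge0.
apply: ler_sum => r r0; apply: le_trans (sphere_cube_sqr _ _ _ _ _ _ r0) => //.
by rewrite ler_wpM2l // lerXn2r ?nnegrE ?sphere_cube_ge0 ?sphere_sum_le.
Qed.

Lemma sum_sphere_sum_le : \sum_r `|sphere_sum r| <= q ^+ (k + k) * n ^+ 2.
Proof.
apply: le_trans (ler_sum _ (fun r _ => sphere_sum_le r)) _.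
exact: sum_sphere_cube.
Qed.

Lemma rep_count_ge0 t : 0 <= rep_count t.
Proof. by apply: sumr_ge0 => p _; rewrite ler0n. Qed.

Lemma sum_rep_count : \sum_t rep_count t = n ^+ 3.
Proof.
rewrite exchange_big /= -natrX -card_triples -sum1_card natr_sum.
apply: eq_bigr => p _; rewrite (bigD1 (sqnorm (tsum p))) //= eqxx big1 ?addr0 //.
by move=> t; rewrite eq_sym => /negbTE ->.
Qed.

(** The trivial bound on the spherical sums gives N(0) <= n^3/q + q^k n^2, and this is at most n^3/2
    + n^3/12 because q >= 2 and n >= 12 q^k. *)
Lemma rep_count0_le : 12%:R * rep_count 0 <= 7%:R * n ^+ 3.
Proof.
have N0 := rep_count_ge0 0.
have q_gt1 : 2%:R <= q by rewrite ler_nat finNzRing_gt1.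
have q1 : 0 <= q - 1 by rewrite subr_ge0 (le_trans _ q_gt1) // ler1n.
have psi1 := psi0 psiD psi_norm.
have rem0 : remainder 0 = - \sum_(r | r != 0) sphere_sum r.
  rewrite /remainder; under eq_bigr do rewrite mulr0 psi1 mulr1.
  rewrite (bigD1 0) //= {1}/rem_coef eqxx add0r -sumrN.
  under eq_bigr => s s0 do rewrite /rem_coef (negbTE s0).
  rewrite exchange_big; apply: eq_bigr => r r0; rewrite -mulr_sumr.
  rewrite -[RHS]mulrN1; congr (_ * _).
  rewrite (reindex_inj (inv_inj (dual_freqK nz2))) /=.
  under eq_bigl => s do rewrite dual_freq_eq0 //.
  under eq_bigr => s _ do rewrite dual_freqK //.
  by rewrite sum_psi_neq0 (negbTE r0) mulr0 add0r.
have step : q * (q ^+ k * rep_count 0) <=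
    q ^+ k * n ^+ 3 + q * (q ^+ (k + k) * n ^+ 2).
  have -> : q * (q ^+ k * rep_count 0) = `|q * g * rep_count 0|.
    by rewrite !normrM (ger0_norm N0) (ger0_norm q0) g_norm mulrA.
  rewrite rep_count_expansion eqxx mulr1 rem0.
  apply: le_trans (ler_normB _ _) _.
  apply: le_trans (lerD (ler_normD _ _) (lexx _)) _.
  rewrite -addrA lerD //; first by rewrite normrM g_norm ger0_norm ?exprn_ge0.
  rewrite normrM (ger0_norm q1) mulrC.
  (* As [q - 1] is at least 1, the nonzero radii can carry the same weight as radius 0. *)
  have le2 : `|\sum_(r | r != 0) sphere_sum r| <=
      (q - 1) * \sum_(r | r != 0) `|sphere_sum r|.
    apply: le_trans (ler_norm_sum _ _ _) _; rewrite ler_peMl ?sumr_ge0 //.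
    by rewrite lerBrDr.
  apply: le_trans (lerD (lexx _) le2) _; rewrite -mulrDr.
  have <- : \sum_r `|sphere_sum r| =
      `|sphere_sum 0| + \sum_(r | r != 0) `|sphere_sum r|.
    by rewrite (bigD1 0).
  apply: ler_pM => //; rewrite ?sumr_ge0 ?sum_sphere_sum_le //.
  by rewrite lerBlDr lerDl.
have {}step : q * rep_count 0 <= n ^+ 3 + q * (q ^+ k * n ^+ 2).
  rewrite -(ler_pM2l (exprn_gt0 k q_gt0)); move: step.
  by rewrite exprD; congr (_ <= _); ring.
rewrite -(ler_pM2l q_gt0) mulrCA.
apply: le_trans (ler_wpM2l _ step) _; first exact: ler0n.
rewrite mulrDr.
have -> : q * (7%:R * n ^+ 3) = 6%:R * (q * n ^+ 3) + q * (n * n ^+ 2) by ring.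
apply: lerD.
  have -> : 12%:R * n ^+ 3 = 6%:R * (2%:R * n ^+ 3) by ring.
  by rewrite ler_wpM2l ?ler0n // ler_wpM2r ?exprn_ge0.
rewrite mulrCA ler_wpM2l // mulrA ler_wpM2r ?exprn_ge0 //.
Qed.

(** Each of the three terms of the expansion contributes at most q * q^d * n^6 to the sum of
    squares, and [norm_sqr_add3] costs a factor 3; hence the 9. *)
Lemma rep_count_l2 :
  q * \sum_(t | t != 0) rep_count t ^+ 2 <= 9%:R * n ^+ 6.
Proof.
have B0 : `|sphere_sum 0| ^+ 2 <= q ^+ (k + k) * n ^+ 6.
  apply: le_trans (_ : (q ^+ (k + k) * n ^+ 2) ^+ 2 <= _).
    rewrite lerXn2r ?nnegrE ?mulr_ge0 ?exprn_ge0 //.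
    apply: le_trans sum_sphere_sum_le; rewrite (bigD1 0) //= lerDl.
    by rewrite sumr_ge0.
  rewrite exprMn expr2 -mulrA ler_wpM2l ?exprn_ge0 // -exprM.
  by rewrite (exprD _ 2 4) ler_wpM2r ?exprn_ge0.
have qk0 : 0 < q * q ^+ (k + k) by rewrite mulr_gt0 ?exprn_gt0.
rewrite -(ler_pM2l qk0).
have -> : q * q ^+ (k + k) * (q * \sum_(t | t != 0) rep_count t ^+ 2) =
    \sum_(t | t != 0) `|q * g * rep_count t| ^+ 2.
  rewrite 2!mulr_sumr; apply: eq_bigr => t _.
  rewrite !normrM 2!exprMn g_norm2 (ger0_norm q0) (ger0_norm (rep_count_ge0 t)).
  by ring.
apply: le_trans (_ : \sum_(t | t != 0) 3%:R * (q ^+ (k + k) * n ^+ 6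
   + q ^+ (k + k) * n ^+ 6 + `|remainder t| ^+ 2) <= _).
  apply: ler_sum => t /negbTE t0.
  rewrite rep_count_expansion t0 mulr0 sub0r mulrN1.
  apply: le_trans (norm_sqr_add3 _ _ _) _; rewrite ler_wpM2l ?ler0n //.
  rewrite lerD2r normrN lerD // normrM exprMn g_norm2 ger0_norm ?exprn_ge0 //.
  by rewrite -exprM.
apply: le_trans (_ : \sum_t 3%:R * (q ^+ (k + k) * n ^+ 6
   + q ^+ (k + k) * n ^+ 6 + `|remainder t| ^+ 2) <= _).
  rewrite big_mkcond; apply: ler_sum => t _; case: ifP => // _.
  by rewrite mulr_ge0 ?addr_ge0 ?mulr_ge0 ?exprn_ge0 ?ler0n.
rewrite -mulr_sumr big_split /= sumr_const -[X in X + _]mulr_natl -/q.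
apply: le_trans (_ : 3%:R * (q * (q ^+ (k + k) * n ^+ 6 + q ^+ (k + k) * n ^+ 6)
  + q * (q ^+ (k + k) * n ^+ 6)) <= _).
  by rewrite ler_wpM2l ?ler0n // lerD2l remainder_l2_le.
by apply: eq_ler; ring.
Qed.

(** At least 5/12 of the triples have nonzero value, and Cauchy-Schwarz against [rep_count_l2] gives
    the density (5/12)^2 / 9 = 25/1296. *)
Lemma Delta3_large : (25 * #|F| <= 1296 * #|Delta3 E|)%N.
Proof.
have n_gt0 : 0 < n by apply: lt_le_trans n_ge; rewrite mulr_gt0 ?exprn_gt0.
have supp t : t \notin Delta3 E -> rep_count t = 0.
  move=> tD; apply: big1 => -[[x1 x2] x3]; rewrite !in_setX /tsum /=.
  case/andP=> /andP[h1 h2] h3; case: eqP => // tE; case/negP: tD.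
  rewrite inE; apply/existsP; exists x1; rewrite h1 /=; apply/existsP; exists x2.
  by rewrite h2 /=; apply/existsP; exists x3; rewrite h3 tE /=.
have sumN : \sum_(t in Delta3 E :\ 0) rep_count t = \sum_(t | t != 0) rep_count t.
  rewrite big_mkcond [RHS]big_mkcond; apply: eq_bigr => t _; rewrite in_setD1.
  by case: (t == 0) => //=; case: ifPn => // /supp ->.
have lower : 5%:R * n ^+ 3 <= 12%:R * \sum_(t in Delta3 E :\ 0) rep_count t.
  rewrite sumN; have := sum_rep_count; rewrite (bigD1 0) //= => sumE.
  have := rep_count0_le; rewrite -sumE => h.
  rewrite -subr_ge0; move: h; rewrite -subr_ge0; congr (0 <= _); ring.
have upper := cauchy_schwarz_card (Delta3 E :\ 0) rep_count.
have S0 : 0 <= \sum_(t in Delta3 E :\ 0) rep_count t.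
  by apply: sumr_ge0 => t _; apply: rep_count_ge0.
rewrite ger0_norm // in upper.
have card_le : #|Delta3 E :\ 0|%:R <= #|Delta3 E|%:R :> algC.
  by rewrite ler_nat subset_leq_card ?subsetDl.
have l2_le : \sum_(t in Delta3 E :\ 0) `|rep_count t| ^+ 2 <=
    \sum_(t | t != 0) rep_count t ^+ 2.
  rewrite big_mkcond [leRHS]big_mkcond; apply: ler_sum => t _; rewrite in_setD1.
  rewrite ger0_norm ?rep_count_ge0 //; case: (t == 0) => //=.
  by case: ifP => // _; rewrite exprn_ge0 ?rep_count_ge0.
rewrite -(ler_nat algC) !natrM -/q -(ler_pM2r (exprn_gt0 6 n_gt0)).
have -> : 25%:R * q * n ^+ 6 = q * (5%:R * n ^+ 3) ^+ 2 by ring.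
apply: le_trans
  (_ : q * (12%:R * \sum_(t in Delta3 E :\ 0) rep_count t) ^+ 2 <= _).
  by rewrite ler_wpM2l // lerXn2r ?nnegrE ?mulr_ge0 ?ler0n ?exprn_ge0.
rewrite exprMn; apply: le_trans (_ : q * (12%:R ^+ 2 *
   (#|Delta3 E|%:R * \sum_(t | t != 0) rep_count t ^+ 2)) <= _).
  rewrite !ler_wpM2l ?exprn_ge0 ?ler0n //; apply: le_trans upper _.
  by apply: ler_pM; rewrite ?ler0n // sumr_ge0 // => t _; rewrite exprn_ge0.
have -> : 1296%:R * #|Delta3 E|%:R * n ^+ 6 =
  144%:R * (#|Delta3 E|%:R * (9%:R * n ^+ 6)) by ring.
have -> : forall x y : algC, q * (12%:R ^+ 2 * (x * y)) = 144%:R * (x * (q * y)).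
  by move=> x y; ring.
by rewrite !ler_wpM2l ?ler0n // rep_count_l2.
Qed.
End Counting.

(** * Comparison of exponents and conclusion *)

Lemma exponent_ge (R : realType) (k : nat) (eps : R) : (4 <= k)%N -> 0 < eps ->
  let e := ((k + k)%:R + 1) / 2 - 1 / (9 * (k + k)%:R - 18) + eps in
  k%:R <= e /\ ((4 * k ^ 2 + k).-1)%:R <= e * ((4 * k).-1)%:R.
Proof.
move=> k4 eps0; set K : R := k%:R.
have K4 : 4 <= K by rewrite /K ler_nat.
have -> : ((4 * k).-1)%:R = 4 * K - 1 :> R.
  by rewrite -subn1 natrB ?natrM //; lia.
have -> : ((4 * k ^ 2 + k).-1)%:R = 4 * K ^+ 2 + K - 1 :> R.
  have gt0 : (0 < 4 * k ^ 2 + k)%N by rewrite addn_gt0 (leq_trans _ k4) ?orbT.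
  by rewrite -subn1 natrB // natrD natrM natrX.
rewrite natrD -/K; set D := 9 * (K + K) - 18.
have D_gt0 : 0 < D by rewrite /D; lra.
have DV : D * D^-1 = 1 by rewrite divff ?gt_eqF.
have DV_ge0 : 0 < D^-1 by rewrite invr_gt0.
(* Since D = 18 K - 18, [K * D^-1] is affine in [D^-1]; the bound 1/54 that follows is the case K =
   4. *)
have DE : K * D^-1 = (1 + 18 * D^-1) / 18.
  by move: DV; rewrite {1}/D; move: (D^-1) => I h; lra.
have DV_le : D^-1 <= 1 / 54 by rewrite -DV mulrC; nra.
split; first by lra.
(* Apart from [eps], what remains is 1/(9d-18) <= 1/(4d-2) with d = 2k. *)
have : 0 <= eps * (4 * K - 1) by rewrite mulr_ge0 //; lra.
by nra.
Qed.

Theorem theorem1p4 (R : realType) (d : nat) (hd : (8 <= d)%N)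
    (hd_even : ~~ odd d) :
  exists c : R, [/\ 0 < c, c <= 1 &
    forall eps : R, 0 < eps ->
    exists C : R, 0 < C /\
      forall (F : finFieldType), 2%N \notin [pchar F] ->
      forall E : {set 'rV[F]_d},
        C * (#|F|%:R `^ ((d%:R + 1) / 2 - 1 / (9 * d%:R - 18) + eps))
          <= #|E|%:R ->
        c * #|F|%:R <= #|Delta3 E|%:R].
Proof.
have [k dE] : exists k, d = (k + k)%N.
  by exists d./2; rewrite addnn even_halfK.
subst d; have k4 : (4 <= k)%N by lia.
exists (25 / 1296); split; [by lra | by lra | move=> eps eps0].
(* One constant, independent of [eps], serves both size conditions, whose factors are 12 and
   [k + 2]. *)
exists (12 * (k + 2))%:R; split; first by rewrite ltr0n; lia.
move=> F char2 E; set e := _ + eps => hE.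
have [ke expo] := exponent_ge k4 eps0; rewrite -/e in ke expo.
have nz2 : 2%:R != 0 :> F by move: char2; rewrite inE.
have q1 : 1 <= #|F|%:R :> R by rewrite ler1n; apply/card_gt0P; exists 0.
have q0 : 0 <= #|F|%:R :> R by apply: le_trans q1.
have hE' (m : nat) : (m <= 12 * (k + 2))%N -> m%:R * #|F|%:R `^ e <= #|E|%:R.
  by move=> hm; apply: le_trans hE; rewrite ler_wpM2r ?powR_ge0 ?ler_nat.
have cardE12 : (12 * #|F| ^ k <= #|E|)%N.
  rewrite -(ler_nat R) natrM natrX -powR_mulrn //.
  apply: le_trans (hE' 12%N _); last by lia.
  by rewrite ler_wpM2l ?ler0n ?ler_powR.
have cardE : ((k + 2) * #|F| ^ (4 * k ^ 2 + k).-1 <= #|E| ^ (4 * k).-1)%N.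
  rewrite -(ler_nat R) natrM !natrX -powR_mulrn //.
  apply: (@le_trans _ _ (((k + 2)%:R * #|F|%:R `^ e) ^+ (4 * k).-1)); last first.
    by rewrite lerXn2r ?nnegrE ?mulr_ge0 ?powR_ge0 ?ler0n ?hE' ?leq_pmull.
  rewrite exprMn; apply: ler_pM; rewrite ?ler0n ?powR_ge0 //.
    by rewrite ler_eXnr ?ler1n //; lia.
  by rewrite -[leRHS]powR_mulrn ?powR_ge0 // -powRrM ler_powR.
have [psi [psiD psi_norm psi_nontriv]] := exists_additive_character F.
have k_gt0 : (0 < k)%N by lia.
have := Delta3_large nz2 psiD psi_norm psi_nontriv k_gt0 cardE cardE12.
by rewrite -(ler_nat R) !natrM => h; lra.
Qed.
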